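(* Let $n>3$ be an integer and let $p=(u_0,\dots,u_{n-1})$ be the $u$-label of an un-branched $n$-flower. Then this flower is univalent if and only if both of the following hold: (A) $\dfrac1{\sqrt3}\le u_j\le\dfrac{n-2}{\sqrt3}$ for all $j=0,\dots,n-1$; (B) $r_j(\vec p^{\,k})\le 1$ for all $j=2,\dots,n-2$ and all $k=0,\dots,n-1$.
   Context: **Circles.** Circles lie on the Riemann sphere $\mathbb P=\mathbb C\cup\{\infty\}$; each circle comes with a chosen interior, an open disc (possibly a half plane or a disc containing $\infty$). Two circles are (externally) tangent if they meet in exactly one point and their interiors are disjoint. Möbius transformations act on circles together with their interiors. For any two ordered triples of mutually tangent circles there is a unique Möbius transformation taking the first triple to the second in order. **Intrinsic schwarzian.** A patch $\{C_v,C_w\,|\,C_a,C_b\}$ consists of four circles such that $\{C_v,C_w,C_a\}$ and $\{C_v,C_w,C_b\}$ are mutually tangent triples. The base patch consists of the circles of radius $\sqrt3$ with $C^\Delta_v$ centered at $1-\sqrt3\,i$, $C^\Delta_w$ at $1+\sqrt3\,i$, $C^\Delta_a$ at $-2$, $C^\Delta_b$ at $4$. For a patch, let $m_f$ be the Möbius transformation taking $(C^\Delta_v,C^\Delta_w,C^\Delta_a)$ to $(C_v,C_w,C_a)$ and $m_g$ the one taking $(C^\Delta_v,C^\Delta_w,C^\Delta_b)$ to $(C_v,C_w,C_b)$. Then $m_g^{-1}\circ m_f$ is represented by a matrix $\begin{bmatrix}1+s&-s\\ s&1-s\end{bmatrix}$ for a unique real $s$, the intrinsic schwarzian of the patch (of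 its edge $\{C_v,C_w\}$). **Flowers.** An $n$-flower $\{C;c_0,\dots,c_{n-1}\}$ ($n\ge3$, indices mod $n$) consists of a central circle $C$ and petals $c_0,\dots,c_{n-1}$, each tangent to $C$, with $c_j$ tangent to $c_{j+1}$ for every $j$. Its label is $(s_0,\dots,s_{n-1})$, where $s_j$ is the intrinsic schwarzian of the patch $\{c_j,C\,|\,c_{j-1},c_{j+1}\}$; its $u$-label is $(u_0,\dots,u_{n-1})$ with $u_j=1-s_j$. Standing assumption: all $s_j<1$, i.e. all $u_j>0$. The $u$-label determines the flower up to Möbius transformations. **Un-branched, univalent.** The flower is un-branched if its petals wrap exactly once around $C$: after a Möbius transformation taking the interior of $C$ to the unit disc, with $\tau_j$ the tangency point of $c_j$ and $C$, the counterclockwise arcs from $\tau_j$ to $\tau_{j+1}$, $j=0,\dots,n-1$ (each of length in $(0,2\pi)$) have total length $2\pi$. It is univalent if it is un-branched and its petals have mutually disjoint interiors. **Normalized layout and $r_j(p)$.** Given the $u$-label $p$ of an un-branched $n$-flower, its normalized layout is the Möbius image of the flower in which the interior of $C$ is the upper half plane, the interior of $c_0$ is the half plane $\{x+iy: y<-2\}$, and $c_1$ is the circle of radius $1$ tangent to $C$ at $0$. The petals $c_1,\dots,c_{n-1}$ are then Euclidean circles tangent to the real line from below, and $r_j(p)$ denotes the Euclidean radius of $c_j$, $1\le j\le n-1$. **Cyclic shift.** $\vec p^{\,k}=(u_k,u_{k+1},\dots,u_{n-1},u_0,\dots,u_{k-1})$ is the cyclic permutation of $p$ that moves the coordinate $u_k$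 to position $0$; it is again the $u$-label of an un-branched flower (the same flower with petals re-indexed so that $c_k$ is called $c_0$). *)

(* Defs.v *)
From mathcomp Require Import all_boot all_order all_algebra.
From mathcomp Require Import complex.
From mathcomp Require Import boolp classical_sets reals trigo.

Set Implicit Arguments.
Unset Strict Implicit.
Unset Printing Implicit Defensive.

Import Order.TTheory GRing.Theory Num.Theory.

Local Open Scope classical_set_scope.
Local Open Scope complex_scope.
Local Open Scope ring_scope.

(* The Riemann sphere: [None] is the point at infinity. *)
Definition sphere (R : realType) : Type := option R[i].

(* A circle on the sphere together with its chosen interior:
   - [Disc c r]      : interior {z : |z - c| < r};
   - [CoDisc c r]    : interior {z : |z - c| > r}, containing infinity;
   - [HalfPlane a v] : interior the open half plane on the left of the line
                       through [a] directed by [v]. *)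
Inductive circle (R : realType) : Type :=
| Disc (c : R[i]) (r : R) of 0 < r
| CoDisc (c : R[i]) (r : R) of 0 < r
| HalfPlane (a v : R[i]) of v != 0.

Definition inner (R : realType) (C : circle R) : set (sphere R) :=
  match C with
  | Disc c r _ => Some @` [set z | `|z - c| < r%:C]
  | CoDisc c r _ => None |` (Some @` [set z | r%:C < `|z - c|])
  | HalfPlane a v _ => Some @` [set z | 0 < complex.Im ((z - a) / v)]
  end.

Definition curve (R : realType) (C : circle R) : set (sphere R) :=
  match C with
  | Disc c r _ | CoDisc c r _ => Some @` [set z | `|z - c| = r%:C]
  | HalfPlane a v _ => None |` (Some @` [set z | complex.Im ((z - a) / v) = 0])
  end.

(* The value at a half plane is irrelevant. *)
Definition radius (R : realType) (C : circle R) : R :=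
  match C with Disc _ r _ | CoDisc _ r _ => r | HalfPlane _ _ _ => 0 end.

Definition tangent_at (R : realType) (C D : circle R) (t : sphere R) : Prop :=
  curve C `&` curve D = [set t] /\ inner C `&` inner D = set0.

Definition tangent (R : realType) (C D : circle R) : Prop :=
  exists t, tangent_at C D t.

Definition tangent3 (R : realType) (C D E : circle R) : Prop :=
  [/\ tangent C D, tangent D E & tangent E C].

Definition mx2 (R : realType) (a b c d : R[i]) : 'M[R[i]]_2 :=
  \matrix_(i, j) if i == 0 then (if j == 0 then a else b)
                 else (if j == 0 then c else d).

(* The map z |-> (M00 z + M01) / (M10 z + M11); a Moebius transformation when
   M is invertible. *)
Definition moebius (R : realType) (M : 'M[R[i]]_2) (z : sphere R) : sphere R :=
  match z with
  | Some z =>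
      if M 1 0 * z + M 1 1 == 0 then None
      else Some ((M 0 0 * z + M 0 1) / (M 1 0 * z + M 1 1))
  | None => if M 1 0 == 0 then None else Some (M 0 0 / M 1 0)
  end.

Definition takes (R : realType) (M : 'M[R[i]]_2) (C D : circle R) : Prop :=
  moebius M @` curve C = curve D /\ moebius M @` inner C = inner D.

Section BasePatch.
Variable R : realType.
Let sqrt3 : R := Num.sqrt 3.

Lemma sqrt3_gt0 : 0 < sqrt3.
Proof. by rewrite sqrtr_gt0. Qed.

Definition base_v : circle R := Disc (1 -i* sqrt3) sqrt3_gt0.
Definition base_w : circle R := Disc (1 +i* sqrt3) sqrt3_gt0.
Definition base_a : circle R := Disc (-2) sqrt3_gt0.
Definition base_b : circle R := Disc 4 sqrt3_gt0.
End BasePatch.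
Arguments base_v {R}.
Arguments base_w {R}.
Arguments base_a {R}.
Arguments base_b {R}.

Definition patch (R : realType) (Cv Cw Ca Cb : circle R) : Prop :=
  tangent3 Cv Cw Ca /\ tangent3 Cv Cw Cb.

(* [s] is the intrinsic schwarzian of the patch {Cv, Cw | Ca, Cb}. *)
Definition schwarzian (R : realType) (Cv Cw Ca Cb : circle R) (s : R) : Prop :=
  patch Cv Cw Ca Cb /\
  exists mf mg : 'M[R[i]]_2,
    [/\ mf \in unitmx /\ mg \in unitmx,
        [/\ takes mf base_v Cv, takes mf base_w Cw & takes mf base_a Ca],
        [/\ takes mg base_v Cv, takes mg base_w Cw & takes mg base_b Cb] &
        moebius (invmx mg) \o moebius mf =1
          moebius (mx2 (1 + s%:C) (- s%:C) s%:C (1 - s%:C))].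

Record flower (R : realType) (n : nat) : Type :=
  Flower { center : circle R; petal : 'I_n -> circle R }.

(* [ordS] and [ord_pred] are the successor and predecessor modulo n. *)
Definition is_flower (R : realType) (n : nat) (F : flower R n) : Prop :=
  [/\ (3 <= n)%N,
      forall j, tangent (center F) (petal F j) &
      forall j, tangent (petal F j) (petal F (ordS j))].

Definition is_ulabel (R : realType) (n : nat) (F : flower R n)
    (p : 'I_n -> R) : Prop :=
  forall j, exists2 s : R,
    schwarzian (petal F j) (center F)
               (petal F (ord_pred j)) (petal F (ordS j)) s &
    p j = 1 - s.

Definition takes_flower (R : realType) (n : nat) (M : 'M[R[i]]_2)
    (F G : flower R n) : Prop :=
  [/\ M \in unitmx, takes M (center F) (center G) &
      forall j, takes M (petal F j) (petal G j)].

(* [G] is the image of the flower in which the interior of the central circle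
   is the unit disc, and [l j] is the length of the counterclockwise arc from
   [tau j] to [tau (j + 1)]. *)
Definition unbranched (R : realType) (n : nat) (F : flower R n) : Prop :=
  exists (M : 'M[R[i]]_2) (G : flower R n)
         (tau : 'I_n -> R[i]) (l : 'I_n -> R),
    [/\ takes_flower M F G,
        inner (center G) = Some @` [set z | `|z| < 1],
        forall j, tangent_at (petal G j) (center G) (Some (tau j)),
        forall j, 0 < l j < 2 * pi /\
                  tau (ordS j) = tau j * (cos (l j) +i* sin (l j)) &
        \sum_j l j = 2 * pi].

Definition univalent (R : realType) (n : nat) (F : flower R n) : Prop :=
  unbranched F /\
  forall j k, j != k -> inner (petal F j) `&` inner (petal F k) = set0.

Definition normalized_layout (R : realType) (n : nat) (p : 'I_n -> R)
    (L : flower R n) : Prop :=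
  (exists (F : flower R n) (M : 'M[R[i]]_2),
     [/\ is_flower F, unbranched F, is_ulabel F p & takes_flower M F L]) /\
  [/\ inner (center L) = Some @` [set z | 0 < complex.Im z],
      forall j : 'I_n, j = 0%N :> nat ->
        inner (petal L j) = Some @` [set z | complex.Im z < -2] &
      forall j : 'I_n, j = 1%N :> nat ->
        radius (petal L j) = 1 /\
        tangent_at (petal L j) (center L) (Some 0)].

(* r_j(p), for 1 <= j <= n - 1. The value is that of any normalized layout
   with u-label p, which is unique; it is 0 when p is not the u-label of an
   un-branched flower. *)
Definition layout_radius (R : realType) (n : nat) (p : 'I_n -> R)
    (j : 'I_n) : R :=
  xget 0 [set r | exists2 L, normalized_layout p L & radius (petal L j) = r].

(* The cyclic permutation j |-> u_((j + k) mod n). *)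
Definition cyclic_shift (R : realType) (n : nat) (p : 'I_n -> R) (k : nat) :
    'I_n -> R :=
  fun j => p (iter k (@ordS n) j).

(* Main.v *)
Require Import Defs.
From mathcomp Require Import all_boot all_order all_algebra.
From mathcomp Require Import complex ring lra zify.
From mathcomp Require Import boolp classical_sets reals trigo.

Set Implicit Arguments.
Unset Strict Implicit.
Unset Printing Implicit Defensive.

Import Order.TTheory GRing.Theory Num.Theory.

Local Open Scope classical_set_scope.
Local Open Scope complex_scope.
Local Open Scope ring_scope.

(* In the normalized layout of the k-th shift, c_k is the half plane Im z < -2
   and every other petal hangs from the real line, so such a petal is disjoint
   from c_k exactly when its radius is at most 1; hence (B) alone says that
   non-consecutive petals are disjoint, and univalence is equivalent to (B).
   In that layout c_(k+1) and c_(k-1) have radius 1 and their centres are at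
   distance 2 sqrt 3 u_k.  Their disjointness gives the lower bound in (A);
   the upper bound follows by walking from c_(k+1) to c_(k-1) through n - 2
   tangencies between discs of radius at most 1.
   That the radii depend only on the u-label comes from rigidity: consecutive
   patches with equal schwarzians are matched by the same Moebius map, because
   a Moebius map is determined by a mutually tangent triple. *)

Lemma big_ord2 (V : nmodType) (f : 'I_2 -> V) : \sum_i f i = f 0 + f 1.
Proof. by rewrite !big_ord_recl big_ord0 addr0; congr (_ + f _); apply/val_inj. Qed.

Lemma ord2P (i : 'I_2) : i = 0 \/ i = 1.
Proof. by case: i => [[|[|//]]] ?; [left|right]; apply/val_inj. Qed.

(** * Moebius transformations as a linear action on homogeneous coordinates *)

Section Projective.
Variable R : realType.
Implicit Types (z : sphere R) (M N : 'M[R[i]]_2) (v : 'cV[R[i]]_2).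

Definition cvec (x y : R[i]) : 'cV[R[i]]_2 := \col_i (if i == 0 then x else y).

(* Homogeneous coordinates turn [moebius] into a linear action. *)
Definition hvec z : 'cV[R[i]]_2 :=
  if z is Some w then cvec w 1 else cvec 1 0.

Definition point v : sphere R :=
  if v 1 0 == 0 then None else Some (v 0 0 / v 1 0).

Lemma cvecE v : v = cvec (v 0 0) (v 1 0).
Proof. by apply/matrixP => i j; rewrite !mxE ord1; case: (ord2P i) => ->. Qed.

Lemma mulmx_cvec M x y :
  M *m cvec x y = cvec (M 0 0 * x + M 0 1 * y) (M 1 0 * x + M 1 1 * y).
Proof.
by apply/matrixP => i j; rewrite !mxE big_ord2 !mxE; case: (ord2P i) => ->.
Qed.

Lemma moebiusE M z : moebius M z = point (M *m hvec z).
Proof.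
case: z => [z|]; rewrite /moebius /hvec mulmx_cvec /point !mxE //=.
  by rewrite !mulr1.
by rewrite !mulr1 !mulr0 !addr0.
Qed.

Lemma hvecK : cancel hvec point.
Proof.
by move=> [z|]; rewrite /hvec /point !mxE /= ?eqxx // oner_eq0 divr1.
Qed.

Lemma hvec_neq0 z : hvec z != 0.
Proof.
apply/eqP => /matrixP e; move: (e 0 0) (e 1 0); rewrite /hvec.
by case: z {e} => [z|]; rewrite !mxE /= => /eqP; rewrite ?oner_eq0 // => _ /eqP; rewrite oner_eq0.
Qed.

Lemma pointZ (c : R[i]) v : c != 0 -> point (c *: v) = point v.
Proof.
move=> c0; rewrite /point !mxE mulf_eq0 (negPf c0) /=.
by case: eqP => // /eqP v0; rewrite -mulf_div divff ?mul1r.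
Qed.

Lemma hvec_point v : v != 0 -> exists2 c, c != 0 & v = c *: hvec (point v).
Proof.
move=> v0; rewrite /point; case: eqP => [v1|/eqP v1].
  exists (v 0 0).
    apply: contra_neq v0 => v00; rewrite [v]cvecE v00 v1.
    by apply/matrixP => i j; rewrite !mxE if_same.
  rewrite [LHS]cvecE v1; apply/matrixP => i j.
  by rewrite !mxE /hvec; case: ifP => _; rewrite ?mulr1 ?mulr0.
exists (v 1 0) => //; rewrite [LHS]cvecE; apply/matrixP => i j; rewrite !mxE.
by case: ifP => _; rewrite ?mulr1 // mulrC divfK.
Qed.

Lemma mulmx_unit_neq0 M v : M \in unitmx -> v != 0 -> M *m v != 0.
Proof.
move=> uM; apply: contra_neq => e.
by rewrite -(mulKmx uM v) e mulmx0.
Qed.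

(** Since [N] is invertible, [N *m hvec z] is nonzero, hence a nonzero multiple of the [hvec] of its
    own point; that scalar disappears under [point]. *)
Lemma moebius_mul M N z :
  N \in unitmx -> moebius (M *m N) z = moebius M (moebius N z).
Proof.
move=> uN; rewrite [RHS]moebiusE [moebius N z]moebiusE moebiusE -mulmxA.
have [c c0 {1}->] := hvec_point (mulmx_unit_neq0 uN (hvec_neq0 z)).
by rewrite -scalemxAr pointZ.
Qed.

Lemma moebius1 z : moebius 1%:M z = z.
Proof. by rewrite moebiusE mul1mx hvecK. Qed.

Lemma moebiusK M : M \in unitmx -> cancel (moebius M) (moebius (invmx M)).
Proof. by move=> uM z; rewrite -moebius_mul // mulVmx // moebius1. Qed.

Lemma moebiusVK M : M \in unitmx -> cancel (moebius (invmx M)) (moebius M).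
Proof. by move=> uM z; rewrite -moebius_mul ?unitmx_inv // mulmxV // moebius1. Qed.

(** A finite fixed point is a root of a polynomial of degree at most 2 in [x] with coefficients
    [M 1 0], [M 1 1 - M 0 0] and [- M 0 1]. Three distinct roots make all of them vanish, so [M] is
    scalar. *)
Lemma moebius_fix3 M (a b c : R[i]) : M \in unitmx ->
  a != b -> b != c -> a != c ->
  moebius M (Some a) = Some a -> moebius M (Some b) = Some b ->
  moebius M (Some c) = Some c -> moebius M =1 id.
Proof.
move=> uM ab bc ac.
have fixP x : moebius M (Some x) = Some x ->
    M 0 0 * x + M 0 1 = x * (M 1 0 * x + M 1 1).
  rewrite /moebius; case: eqP => // /eqP d0 [] /(congr1 (fun w => w * (M 1 0 * x + M 1 1))).
  by rewrite divfK.
move=> /fixP fa /fixP fb /fixP fc.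
have h x y : x != y -> M 0 0 * x + M 0 1 = x * (M 1 0 * x + M 1 1) ->
    M 0 0 * y + M 0 1 = y * (M 1 0 * y + M 1 1) ->
    M 1 0 * (x + y) + M 1 1 - M 0 0 = 0.
  move=> xy fx fy; have /eqP : (x - y) * (M 1 0 * (x + y) + M 1 1 - M 0 0) = 0.
    transitivity (x * (M 1 0 * x + M 1 1) - y * (M 1 0 * y + M 1 1) - M 0 0 * (x - y)).
      ring.
    by rewrite -fx -fy; ring.
  by rewrite mulf_eq0 subr_eq0 (negPf xy) => /eqP.
have hab := h _ _ ab fa fb; have hbc := h _ _ bc fb fc.
have M10 : M 1 0 = 0.
  have /eqP : (a - c) * M 1 0 = 0.
    by rewrite -[RHS](subrr 0) -{1}hab -hbc; ring.
  by rewrite mulf_eq0 subr_eq0 (negPf ac) => /eqP.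
have M11 : M 1 1 = M 0 0.
  by apply/eqP; rewrite -subr_eq0; move: hab; rewrite M10 mul0r add0r => ->.
have M01 : M 0 1 = 0.
  by move: fa; rewrite M10 M11 mul0r add0r mulrC => /(canRL (addKr _)) ->; rewrite addNr.
have ME : M = (M 0 0)%:M.
  apply/matrixP => i j; rewrite !mxE.
  by case: (ord2P i) => ->; case: (ord2P j) => ->; rewrite ?M10 ?M01 ?M11.
have M00 : M 0 0 != 0.
  by apply/eqP => M00; move: uM; rewrite ME M00 unitmxE det_scalar expr0n unitr0.
by move=> z; rewrite moebiusE ME mul_scalar_mx pointZ // hvecK.
Qed.

Lemma takes_mul M N (C D E : circle R) : N \in unitmx ->
  takes N C D -> takes M D E -> takes (M *m N) C E.
Proof.
move=> uN [c1 i1] [c2 i2].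
have e : moebius (M *m N) = moebius M \o moebius N.
  by apply: funext => z; rewrite moebius_mul.
by split; rewrite e -image_comp ?c1 ?i1.
Qed.

Lemma takes_inv M (C D : circle R) : M \in unitmx ->
  takes M C D -> takes (invmx M) D C.
Proof.
move=> uM [c i].
have e : moebius (invmx M) \o moebius M = id.
  by apply: funext => z /=; rewrite moebiusK.
by split; rewrite -?c -?i image_comp e image_id.
Qed.

Lemma takes_ext M N (C D : circle R) : moebius M =1 moebius N ->
  takes M C D -> takes N C D.
Proof. by move=> /funext e; rewrite /takes e. Qed.

Lemma takes_preimage M (C D : circle R) : M \in unitmx ->
  (forall z, inner C z <-> inner D (moebius M z)) ->
  (forall z, curve C z <-> curve D (moebius M z)) -> takes M C D.
Proof.
move=> uM hi hc; split; apply/seteqP; split => [z [w] /[swap] <-|z zD] /=.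
- by move/hc.
- by exists (moebius (invmx M) z); rewrite ?moebiusVK //; apply/hc; rewrite moebiusVK.
- by move/hi.
- by exists (moebius (invmx M) z); rewrite ?moebiusVK //; apply/hi; rewrite moebiusVK.
Qed.

Lemma takes_inner M (C D : circle R) z :
  M \in unitmx -> takes M C D -> inner C z <-> inner D (moebius M z).
Proof.
move=> uM [_ <-]; split => [Cz|[w Cw /(can_inj (moebiusK uM)) <- //]].
by exists z.
Qed.

Lemma takes_curve M (C D : circle R) z :
  M \in unitmx -> takes M C D -> curve C z <-> curve D (moebius M z).
Proof.
move=> uM [<- _]; split => [Cz|[w Cw /(can_inj (moebiusK uM)) <- //]].
by exists z.
Qed.

Lemma takes_tangent_at M (C C' D D' : circle R) t : M \in unitmx ->
  takes M C C' -> takes M D D' ->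
  tangent_at C D t -> tangent_at C' D' (moebius M t).
Proof.
move=> uM tC tD [ht hi]; split; apply/seteqP; split => z.
- rewrite -(moebiusVK uM z) => -[/(takes_curve _ uM tC) cz /(takes_curve _ uM tD) dz].
  have : (curve C `&` curve D) (moebius (invmx M) z) by [].
  by rewrite ht => ->.
- move=> ->; have [] : (curve C `&` curve D) t by rewrite ht.
  by move=> /(takes_curve _ uM tC) ? /(takes_curve _ uM tD).
- rewrite -(moebiusVK uM z) => -[/(takes_inner _ uM tC) cz /(takes_inner _ uM tD) dz].
  have : (inner C `&` inner D) (moebius (invmx M) z) by [].
  by rewrite hi.
- by [].
Qed.

Lemma takes_disjoint M (C C' D D' : circle R) : M \in unitmx ->
  takes M C C' -> takes M D D' ->
  inner C `&` inner D = set0 <-> inner C' `&` inner D' = set0.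
Proof.
move=> uM tC tD; split => h; rewrite -subset0 => z.
  rewrite -(moebiusVK uM z) => -[/(takes_inner _ uM tC) cz /(takes_inner _ uM tD) dz].
  by suff : set0 (moebius (invmx M) z) by []; rewrite -h.
move=> [/(takes_inner _ uM tC) cz /(takes_inner _ uM tD) dz].
by suff : set0 (moebius M z) by []; rewrite -h.
Qed.

End Projective.

(** The norm on [R[i]] has its values in [R[i]]; this real-valued square turns membership in discs
    into polynomial inequalities over [R]. *)
Definition sqnorm (R : realType) (z : R[i]) : R :=
  complex.Re z ^+ 2 + complex.Im z ^+ 2.

Ltac complex_ring := rewrite /sqnorm; simpc; congr (_ +i* _); rewrite /=; ring.

(** * Circles as indefinite Hermitian forms, and their images under Moebius maps *)

Section HermitianForms.
Variable R : realType.
Implicit Types (z w c : R[i]) (M N H : 'M[R[i]]_2) (v : 'cV[R[i]]_2).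
Local Notation Re := complex.Re.
Local Notation Im := complex.Im.

Lemma complex_eq (x y : R[i]) : Re x = Re y -> Im x = Im y -> x = y.
Proof. by move=> e1 e2; apply/eqP; rewrite eq_complex e1 e2 !eqxx. Qed.

Lemma norm_lt z (r : R) : 0 < r -> (`|z| < r%:C) = (sqnorm z < r ^+ 2).
Proof.
move=> r0; rewrite normc_def ltcR -[r in LHS]ger0_norm ?ltW // -sqrtr_sqr.
by rewrite ltr_sqrt // exprn_gt0.
Qed.

Lemma norm_gt z (r : R) : 0 < r -> (r%:C < `|z|) = (r ^+ 2 < sqnorm z).
Proof.
move=> r0; rewrite normc_def ltcR -[r in LHS]ger0_norm ?ltW // -sqrtr_sqr.
have [zp|/negP zn] := boolP (0 < sqnorm z); first by rewrite ltr_sqrt.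
have z0 : sqnorm z = 0.
  apply/eqP; rewrite eq_le addr_ge0 ?sqr_ge0 // andbT leNgt; exact/negP.
have -> : Re z ^+ 2 + Im z ^+ 2 = 0 by [].
by rewrite z0 sqrtr0 !ltNge sqrtr_ge0 sqr_ge0.
Qed.

Lemma norm_eq z (r : R) : 0 < r -> `|z| = r%:C <-> sqnorm z = r ^+ 2.
Proof.
move=> r0; rewrite normc_def; split=> [/complexI <-|].
  by rewrite sqr_sqrtr // addr_ge0 ?sqr_ge0.
by rewrite /sqnorm => ->; rewrite sqrtr_sqr gtr0_norm.
Qed.

Definition adjoint (m n : nat) (A : 'M[R[i]]_(m, n)) := (map_mx conjc A)^T.

Lemma adjointM (m n k : nat) (A : 'M[R[i]]_(m, n)) (B : 'M_(n, k)) :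
  adjoint (A *m B) = adjoint B *m adjoint A.
Proof. by rewrite /adjoint map_mxM trmx_mul. Qed.

Lemma adjointK (m n : nat) : cancel (@adjoint m n) (@adjoint n m).
Proof. by move=> A; apply/matrixP => i j; rewrite !mxE conjcK. Qed.

Lemma det_adjoint M : \det (adjoint M) = conjc (\det M).
Proof. by rewrite det_tr det_map_mx. Qed.

Definition hval H v : R[i] := (adjoint v *m H *m v) 0 0.

Lemma hval_mulmx H M v : hval H (M *m v) = hval (adjoint M *m H *m M) v.
Proof. by rewrite /hval adjointM !mulmxA. Qed.

(** The factor is real and nonnegative, so the sign of a form depends only on the projective
    point. *)
Lemma hvalZ H (a : R[i]) v : hval H (a *: v) = (sqnorm a)%:C * hval H v.
Proof.
rewrite /hval -scalemxAr mxE.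
have -> : adjoint (a *: v) = (conjc a) *: adjoint v.
  by apply/matrixP => i j; rewrite !mxE rmorphM.
by rewrite -!scalemxAl mxE mulrA; congr (_ * _); case: a => x y; complex_ring.
Qed.

Lemma hval_scale (a : R[i]) H v : hval (a *: H) v = a * hval H v.
Proof. by rewrite /hval -scalemxAr -scalemxAl mxE. Qed.

Lemma hval_cvec H x y :
  hval H (cvec x y) =
  ((conjc x) * H 0 0 + (conjc y) * H 1 0) * x + ((conjc x) * H 0 1 + (conjc y) * H 1 1) * y.
Proof. by rewrite /hval !mxE big_ord2 !mxE !big_ord2 !mxE. Qed.

Lemma mx2E M : M = mx2 (M 0 0) (M 0 1) (M 1 0) (M 1 1).
Proof.
apply/matrixP => i j.
by case: (ord2P i) => ->; case: (ord2P j) => ->; rewrite !mxE.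
Qed.

Lemma det_mx2 a b c d : \det (mx2 a b c d : 'M[R[i]]_2) = a * d - b * c.
Proof. rewrite (expand_det_row _ 0) big_ord2 /cofactor !det_mx11 !mxE /=.
by rewrite expr0 expr1 mul1r mulN1r mulrN. Qed.

(* The interior is where the Hermitian form is negative and the circle is its
   zero set, see [innerE] and [curveE]. *)
Definition form (C : circle R) : 'M[R[i]]_2 :=
  match C with
  | Disc c r _ => mx2 1 (- c) (- (conjc c)) (sqnorm c - r ^+ 2)%:C
  | CoDisc c r _ => mx2 (-1) c (conjc c) (r ^+ 2 - sqnorm c)%:C
  | HalfPlane a v _ => mx2 0 (- ('i * v)) ('i * (conjc v)) ('i * ((conjc a) * v - a * (conjc v)))
  end.

Lemma hval_form_Disc c (r : R) (r0 : 0 < r) z :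
  hval (form (Disc c r0)) (hvec (Some z)) = (sqnorm (z - c) - r ^+ 2)%:C.
Proof.
rewrite hval_cvec !mxE /=; case: z => x y; case: c => a b.
by complex_ring.
Qed.

Lemma hval_form_CoDisc c (r : R) (r0 : 0 < r) z :
  hval (form (CoDisc c r0)) (hvec (Some z)) = (r ^+ 2 - sqnorm (z - c))%:C.
Proof.
rewrite hval_cvec !mxE /=; case: z => x y; case: c => a b.
by complex_ring.
Qed.

Lemma Im_div z w : w != 0 -> Im (z / w) = Im (z * (conjc w)) / sqnorm w.
Proof.
case: z w => x y [a b] _ /=; rewrite /sqnorm /=; ring.
Qed.

Lemma sqnorm_gt0 w : w != 0 -> 0 < sqnorm w.
Proof.
move=> w0; rewrite lt_def addr_ge0 ?sqr_ge0 // andbT.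
apply: contraNneq w0 => /eqP; rewrite paddr_eq0 ?sqr_ge0 // !sqrf_eq0.
by case: w => a b /= /andP[/eqP -> /eqP ->].
Qed.

Lemma hval_form_HalfPlane a w (w0 : w != 0) z :
  hval (form (HalfPlane a w0)) (hvec (Some z)) =
  (- 2 * sqnorm w * Im ((z - a) / w))%:C.
Proof.
have s0 : sqnorm w != 0 by rewrite gt_eqF // sqnorm_gt0.
have -> : - 2 * sqnorm w * Im ((z - a) / w) = - 2 * Im ((z - a) * (conjc w)).
  by rewrite Im_div //; field.
rewrite hval_cvec !mxE /=; case: z => x y; case: a => a b; case: w {w0 s0} => c d.
by complex_ring.
Qed.

Lemma hval_None H : hval H (hvec None) = H 0 0.
Proof.
by rewrite hval_cvec conjc0 conjc1 mul1r !mul0r !addr0 mulr1 mulr0 addr0.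
Qed.

Lemma innerE (C : circle R) (z : sphere R) :
  inner C z <-> hval (form C) (hvec z) < 0.
Proof.
case: z => [z|]; last first.
  rewrite hval_None; case: C => [c r r0|c r r0|a v v0]; rewrite !mxE !eqxx.
  - by rewrite le_gtF ?ler01 //; split => // -[].
  - by rewrite oppr_lt0 ltr01; split => // _; left.
  - by rewrite ltxx; split => // -[].
case: C => [c r r0|c r r0|a v v0].
- rewrite hval_form_Disc ltcR subr_lt0 -norm_lt //.
  by split => [[w wP [<-]]|zP] //; exists z.
- rewrite hval_form_CoDisc ltcR subr_lt0 -norm_gt //.
  by split => [[//|[w wP [<-]]]|zP] //; right; exists z.
- rewrite hval_form_HalfPlane ltcR mulNr mulNr oppr_lt0 pmulr_rgt0 ?mulr_gt0 ?sqnorm_gt0 //.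
  by split => [[w wP [<-]]|zP] //; exists z.
Qed.

Lemma curveE (C : circle R) (z : sphere R) :
  curve C z <-> hval (form C) (hvec z) = 0.
Proof.
case: z => [z|]; last first.
  rewrite hval_None; case: C => [c r r0|c r r0|a v v0]; rewrite !mxE !eqxx.
  - by split => [[]//|/eqP]; rewrite oner_eq0.
  - by split => [[]//|/eqP]; rewrite oppr_eq0 oner_eq0.
  - by split => // _; left.
case: C => [c r r0|c r r0|a v v0].
- rewrite hval_form_Disc; split => [[w /norm_eq-/(_ r0) e [<-]]|/complexI/eqP].
    by rewrite e subrr.
  by rewrite subr_eq0 => /eqP/norm_eq-/(_ r0) e; exists z.
- rewrite hval_form_CoDisc; split => [[w /norm_eq-/(_ r0) e [<-]]|/complexI/eqP].
    by rewrite e subrr.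
  by rewrite subr_eq0 eq_sym => /eqP/norm_eq-/(_ r0) e; exists z.
- rewrite hval_form_HalfPlane; split => [[//|[w wP [<-]]]|/complexI/eqP].
    by rewrite wP mulr0.
  rewrite !mulf_eq0 oppr_eq0 pnatr_eq0 (gt_eqF (sqnorm_gt0 v0)) => /eqP zP.
  by right; exists z.
Qed.

Lemma form_adjoint (C : circle R) : adjoint (form C) = form C.
Proof.
apply/matrixP => i j; rewrite /adjoint 2!mxE.
case: (ord2P i) => ->; case: (ord2P j) => ->; case: C => [[x y] r r0|[x y] r r0|[x y] [a b] v0];
  rewrite !mxE /=; complex_ring.
Qed.

(** The determinant is [- r ^+ 2] for a disc or the complement of one, and minus the squared modulus
    of the direction for a half plane. *)
Lemma form_det (C : circle R) : \det (form C) < 0.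
Proof.
case: C => [[x y] r r0|[x y] r r0|[x y] w w0]; rewrite det_mx2.
- rewrite [X in X < _](_ : _ = (- r ^+ 2)%:C); last by complex_ring.
  by rewrite ltcR oppr_lt0 exprn_gt0.
- rewrite [X in X < _](_ : _ = (- r ^+ 2)%:C); last by complex_ring.
  by rewrite ltcR oppr_lt0 exprn_gt0.
- rewrite [X in X < _](_ : _ = (- sqnorm w)%:C).
    by rewrite ltcR oppr_lt0 sqnorm_gt0.
  by case: w {w0} => a b; complex_ring.
Qed.

(** The sign of the real entry [a = H 0 0] selects the constructor. For nonzero [a], completing the
    square gives the centre [- H 0 1 / a] and the radius sqrt(- det H) / |a|. The factor [k] is
    positive so that the interior is not exchanged with the exterior. *)
Lemma circle_of_form H : adjoint H = H -> \det H < 0 ->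
  exists (C : circle R) (k : R), 0 < k /\ form C = k%:C *: H.
Proof.
move=> hH dH.
have conjH i j : conjc (H j i) = H i j by rewrite -[in RHS]hH !mxE.
have realH i : exists x : R, H i i = x%:C.
  have := conjH i i; case: (H i i) => x y [/eqP].
  by rewrite -subr_eq0 -opprD oppr_eq0 -mulr2n mulrn_eq0 => /eqP ->; exists x.
have [a Ha] := realH 0; have [d Hd] := realH 1.
have [b [c Hbc]] : exists b c : R, H 0 1 = b +i* c by case: (H 0 1) => b c; exists b, c.
have HE : H = mx2 a%:C (b +i* c) (b -i* c) d%:C.
  by rewrite [LHS]mx2E -(conjH 1 0) Ha Hd Hbc.
have D0 : 0 < b ^+ 2 + c ^+ 2 - a * d.
  move: dH; rewrite HE det_mx2.
  rewrite [X in X < _](_ : _ = (- (b ^+ 2 + c ^+ 2 - a * d))%:C); last by complex_ring.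
  by rewrite ltcR oppr_lt0.
have s2 := sqr_sqrtr (ltW D0).
have s0 : 0 < Num.sqrt (b ^+ 2 + c ^+ 2 - a * d) by rewrite sqrtr_gt0.
move: (Num.sqrt _) s2 s0 => s s2 s0.
have mxZ (k : R) x y z t : k%:C *: mx2 x y z t = mx2 (k%:C * x) (k%:C * y) (k%:C * z) (k%:C * t).
  by rewrite [LHS]mx2E !mxE.
case: (ltgtP a 0) => a0.
- have r0 : 0 < s / - a by rewrite divr_gt0 // oppr_gt0.
  exists (CoDisc ((- b / a) +i* (- c / a)) r0), (- a^-1).
  split; first by rewrite oppr_gt0 invr_lt0.
  rewrite HE mxZ /=; congr mx2; rewrite /sqnorm; simpc; congr (_ +i* _) => //=; try ring.
  + by field; rewrite lt_eqF.
  + by rewrite expr_div_n s2; field; rewrite lt_eqF.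
- have r0 : 0 < s / a by rewrite divr_gt0.
  exists (Disc ((- b / a) +i* (- c / a)) r0), a^-1.
  split; first by rewrite invr_gt0.
  rewrite HE mxZ /=; congr mx2; rewrite /sqnorm; simpc; congr (_ +i* _) => //=; try ring.
  + by field; rewrite gt_eqF.
  + by rewrite expr_div_n s2; field; rewrite gt_eqF.
- rewrite a0 mul0r subr0 in D0.
  (* For [a = 0] the line has normal [b +i* c]; the direction is the normal times i, and the base
     point is the foot of the perpendicular from the origin. *)
  have v0 : (- c) +i* b != 0.
    apply: contraTneq D0 => -[/eqP]; rewrite oppr_eq0 => /eqP -> ->.
    by rewrite expr0n addr0 ltxx.
  pose N := 2 * (b ^+ 2 + c ^+ 2).
  exists (HalfPlane ((- d * b / N) +i* (- d * c / N)) v0), 1.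
  split => //; rewrite HE a0 scale1r /=; congr mx2; simpc; congr (_ +i* _) => //=; try ring.
  by rewrite /N; field; rewrite gt_eqF.
Qed.

(** Along [moebius M] the two forms differ by a positive factor, which preserves both the negative
    set and the zero set. *)
Lemma takes_of_form M (C D : circle R) (k : R) : M \in unitmx -> 0 < k ->
  adjoint M *m form D *m M = k%:C *: form C -> takes M C D.
Proof.
move=> uM k0 e.
have key (z : sphere R) : exists2 c : R, 0 < c &
    hval (form D) (hvec (moebius M z)) * c%:C = hval (form C) (hvec z).
  have [c c0 cE] := hvec_point (mulmx_unit_neq0 uM (hvec_neq0 z)).
  have n0 := sqnorm_gt0 c0; rewrite -moebiusE in cE.
  exists (sqnorm c / k); first by rewrite divr_gt0.
  have k0C : k%:C != 0 by rewrite -(rmorph0 (real_complex R)) (inj_eq (@complexI _)) gt_eqF.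
  apply: (mulfI k0C); rewrite -[RHS]hval_scale -e -hval_mulmx cE hvalZ.
  by rewrite rmorphM /= fmorphV /=; field.
apply: takes_preimage => // z; have [c c0 cE] := key z.
  by rewrite !innerE -cE pmulr_llt0 ?ltcR.
rewrite !curveE -cE; split=> [/eqP|->]; last by rewrite mul0r.
rewrite mulf_eq0 => /orP[/eqP//|/eqP/complexI c00].
by move: c0; rewrite c00 ltxx.
Qed.

(** Transporting the form by the inverse [V] of [M] keeps it Hermitian and multiplies its
    determinant by |det V|^2, so the result is again the form of a circle up to a positive
    factor. *)
Lemma takes_exists M (C : circle R) : M \in unitmx -> exists D, takes M C D.
Proof.
move=> uM; pose V := invmx M; pose H := adjoint V *m form C *m V.
have dV : \det V != 0 by rewrite -unitfE -unitmxE unitmx_inv.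
have [||D [k [k0 DE]]] := @circle_of_form H.
- by rewrite /H !adjointM adjointK form_adjoint mulmxA.
- rewrite /H !det_mulmx det_adjoint mulrAC.
  have -> : conjc (\det V) * \det V = (sqnorm (\det V))%:C.
    by case: (\det V) => x y; complex_ring.
  by rewrite pmulr_rlt0 ?form_det // ltcR sqnorm_gt0.
exists D; apply: (takes_of_form uM k0).
rewrite DE -scalemxAr -scalemxAl /H -!mulmxA mulVmx // mulmx1 mulmxA -adjointM.
by rewrite mulVmx // /adjoint map_mx1 trmx1 mul1mx.
Qed.

Lemma inner_Disc c (r : R) (r0 : 0 < r) z :
  inner (Disc c r0) (Some z) <-> sqnorm (z - c) < r ^+ 2.
Proof. by rewrite innerE hval_form_Disc ltcR subr_lt0. Qed.

Lemma curve_Disc c (r : R) (r0 : 0 < r) z :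
  curve (Disc c r0) (Some z) <-> sqnorm (z - c) = r ^+ 2.
Proof.
rewrite curveE hval_form_Disc; split => [/complexI/eqP|->]; last by rewrite subrr.
by rewrite subr_eq0 => /eqP.
Qed.

Lemma inner_CoDisc c (r : R) (r0 : 0 < r) z :
  inner (CoDisc c r0) (Some z) <-> r ^+ 2 < sqnorm (z - c).
Proof. by rewrite innerE hval_form_CoDisc ltcR subr_lt0. Qed.

Lemma inner_HalfPlane a w (w0 : w != 0) z :
  inner (HalfPlane a w0) (Some z) <-> 0 < Im ((z - a) / w).
Proof. by split => [[? ? [<-]]|] //; exists z. Qed.

Lemma curve_HalfPlane a w (w0 : w != 0) z :
  curve (HalfPlane a w0) (Some z) <-> Im ((z - a) / w) = 0.
Proof. by split => [[//|[? ? [<-]]]|] //; right; exists z. Qed.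

End HermitianForms.

(** * Rigidity of tangent triples and of patches *)

Section Patches.
Variable R : realType.
Implicit Types (z c : R[i]) (M N P : 'M[R[i]]_2).
Local Notation Re := complex.Re.
Local Notation Im := complex.Im.
Local Notation sqrt3 := (Num.sqrt 3 : R).

Lemma sqrt3_sqr : sqrt3 ^+ 2 = 3.
Proof. by rewrite sqr_sqrtr. Qed.

(** By the parallelogram identity, a common point [z] satisfies |2z - c - c'|^2 = 4r^2 - |c - c'|^2
    = 0. *)
Lemma curve_Disc_tangent c c' (r : R) (r0 : 0 < r) :
  sqnorm (c - c') = (2 * r) ^+ 2 ->
  curve (Disc c r0) `&` curve (Disc c' r0) = [set Some ((c + c') / 2)].
Proof.
case: c => a b; case: c' => a' b' e.
have -> : ((a +i* b) + (a' +i* b')) / 2 = ((a + a') / 2) +i* ((b + b') / 2).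
  apply: (mulIf (_ : 2 != 0 :> R[i])); first by rewrite pnatr_eq0.
  by rewrite divfK ?pnatr_eq0 //; apply: complex_eq => /=; field.
rewrite /sqnorm /= in e.
apply/seteqP; split => [[[x y]|] /=|z -> /=].
- move=> [/curve_Disc + /curve_Disc]; rewrite /sqnorm /= => e1 e2.
  have /eqP : (2 * x - a - a') ^+ 2 + (2 * y - b - b') ^+ 2 = 0. by lra.
  rewrite paddr_eq0 ?sqr_ge0 // !sqrf_eq0 => /andP[/eqP xE /eqP yE].
  by congr (Some (_ +i* _)); lra.
- by case=> -[].
- by split; apply/curve_Disc; rewrite /sqnorm /=; lra.
Qed.

Lemma base_vw : curve base_v `&` curve base_w = [set Some (1 : R[i])].
Proof.
rewrite curve_Disc_tangent.
  congr [set Some _].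
  apply: (mulIf (_ : 2 != 0 :> R[i])); first by rewrite pnatr_eq0.
  by rewrite divfK ?pnatr_eq0 // mul1r; apply: complex_eq => /=; ring.
by rewrite /sqnorm /=; have := sqrt3_sqr; lra.
Qed.

Lemma base_va : curve base_v `&` curve base_a = [set Some ((- 1 / 2) -i* (sqrt3 / 2))].
Proof.
rewrite curve_Disc_tangent.
  congr [set Some _].
  apply: (mulIf (_ : 2 != 0 :> R[i])); first by rewrite pnatr_eq0.
  by rewrite divfK ?pnatr_eq0 //; apply: complex_eq => /=; field.
by rewrite /sqnorm /=; have := sqrt3_sqr; lra.
Qed.

Lemma base_wa : curve base_w `&` curve base_a = [set Some ((- 1 / 2) +i* (sqrt3 / 2))].
Proof.
rewrite curve_Disc_tangent.
  congr [set Some _].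
  apply: (mulIf (_ : 2 != 0 :> R[i])); first by rewrite pnatr_eq0.
  by rewrite divfK ?pnatr_eq0 //; apply: complex_eq => /=; field.
by rewrite /sqnorm /=; have := sqrt3_sqr; lra.
Qed.

(** The three tangency points of the base triple, which are the cube roots of unity, are fixed. *)
Lemma base_takes_id M : M \in unitmx ->
  takes M base_v base_v -> takes M base_w base_w -> takes M base_a base_a ->
  moebius M =1 id.
Proof.
move=> uM tv tw ta.
have fix_pt (C D : circle R) t : takes M C C -> takes M D D ->
    curve C `&` curve D = [set t] -> moebius M t = t.
  move=> tC tD h; have [] : (curve C `&` curve D) t by rewrite h.
  move=> /(takes_curve _ uM tC) ct /(takes_curve _ uM tD) dt.
  have : (curve C `&` curve D) (moebius M t) by [].
  by rewrite h.
have s0 : 0 < sqrt3 by rewrite sqrtr_gt0.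
apply: (moebius_fix3 uM _ _ _ (fix_pt _ _ _ tv tw base_vw)
  (fix_pt _ _ _ tv ta base_va) (fix_pt _ _ _ tw ta base_wa));
  rewrite eq_complex /=; apply/nandP; (try by left; lra); right; lra.
Qed.

(** [P] presents the source triple as an image of the base triple; then the inverse of [N *m P]
    composed with [M *m P] preserves each base circle, hence is the identity map. *)
Lemma takes_triple_unique M N P (C1 C2 C3 D1 D2 D3 : circle R) :
  M \in unitmx -> N \in unitmx -> P \in unitmx ->
  takes P base_v C1 -> takes P base_w C2 -> takes P base_a C3 ->
  takes M C1 D1 -> takes M C2 D2 -> takes M C3 D3 ->
  takes N C1 D1 -> takes N C2 D2 -> takes N C3 D3 ->
  moebius M =1 moebius N.
Proof.
move=> uM uN uP p1 p2 p3 m1 m2 m3 n1 n2 n3.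
pose W := invmx (N *m P) *m (M *m P).
have uNP : N *m P \in unitmx by rewrite unitmx_mul uN.
have uMP : M *m P \in unitmx by rewrite unitmx_mul uM.
have uW : W \in unitmx by rewrite unitmx_mul unitmx_inv uNP.
have tW B C D : takes P B C -> takes M C D -> takes N C D -> takes W B B.
  move=> tP tM tN; apply: (takes_mul uMP (takes_mul uP tP tM)).
  exact: (takes_inv uNP (takes_mul uP tP tN)).
have WE := base_takes_id uW (tW _ _ _ p1 m1 n1) (tW _ _ _ p2 m2 n2) (tW _ _ _ p3 m3 n3).
move=> z; have := WE (moebius (invmx P) z); rewrite moebius_mul //.
move/(congr1 (moebius (N *m P))); rewrite moebiusVK // !moebius_mul //.
by rewrite moebiusVK.
Qed.

(** The map f' f^-1 matches the first triples by construction. Equal schwarzians give g^-1 f = g'^-1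
    f', so it coincides with g' g^-1, which matches [Cb] with [Db]. *)
Lemma patch_rigid (Cv Cw Ca Cb Dv Dw Da Db : circle R) s :
  schwarzian Cv Cw Ca Cb s -> schwarzian Dv Dw Da Db s ->
  exists M, [/\ M \in unitmx, takes M Cv Dv, takes M Cw Dw, takes M Ca Da & takes M Cb Db].
Proof.
move=> [_ [f [g [[uf ug] [fv fw fa] [gv gw gb] e]]]].
move=> [_ [f' [g' [[uf' ug'] [fv' fw' fa'] [gv' gw' gb'] e']]]].
exists (f' *m invmx f).
have uV : invmx f \in unitmx by rewrite unitmx_inv.
have uVg : invmx g \in unitmx by rewrite unitmx_inv.
have t (B C D : circle R) : takes f B C -> takes f' B D -> takes (f' *m invmx f) C D.
  by move=> tC tD; apply: (takes_mul uV (takes_inv uf tC) tD).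
split; [by rewrite unitmx_mul uf' | exact: t fv fv' | exact: t fw fw' | exact: t fa fa' |].
apply: takes_ext (takes_mul uVg (takes_inv ug gb) gb') => z.
rewrite !moebius_mul //.
have /= := e (moebius (invmx f) z); rewrite moebiusVK // => ->.
by rewrite -e' /= moebiusVK.
Qed.

End Patches.

(** * Normalizing a patch: central circle to [upper], middle petal to [below] *)

Section Layout.
Variable R : realType.
Implicit Types (z c : R[i]) (M N P : 'M[R[i]]_2).
Local Notation Re := complex.Re.
Local Notation Im := complex.Im.
Local Notation sqrt3 := (Num.sqrt 3 : R).

Definition upper : circle R := HalfPlane 0 (oner_neq0 _).
Lemma minus1_neq0 : -1 != 0 :> R[i].
Proof. by rewrite oppr_eq0 oner_neq0. Qed.
Definition below : circle R := HalfPlane (0 -i* 2) minus1_neq0.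
Definition unit_below (x : R) : circle R := Disc (x -i* 1) ltr01.

(* z |-> (sqrt 3 - i) - 2 sqrt 3 / (z - 1); it sends the tangency point of
   [base_v] and [base_w] to infinity. *)
Definition straighten : 'M[R[i]]_2 :=
  mx2 (sqrt3 -i* 1) ((- 3 * sqrt3) +i* 1) 1 (-1).

Lemma adjoint_mx2 (a b c d : R[i]) :
  adjoint (mx2 a b c d) = mx2 (conjc a) (conjc c) (conjc b) (conjc d).
Proof. by rewrite [LHS]mx2E !mxE. Qed.

Lemma mul_mx2 (a b c d a' b' c' d' : R[i]) :
  mx2 a b c d *m mx2 a' b' c' d' =
  mx2 (a * a' + b * c') (a * b' + b * d') (c * a' + d * c') (c * b' + d * d').
Proof. by rewrite [LHS]mx2E !mxE !big_ord2 !mxE. Qed.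

Lemma scale_mx2 (k a b c d : R[i]) :
  k *: mx2 a b c d = mx2 (k * a) (k * b) (k * c) (k * d).
Proof. by rewrite [LHS]mx2E !mxE. Qed.

Lemma straighten_unit : straighten \in unitmx.
Proof.
rewrite unitmxE unitfE det_mx2 eq_complex /=; apply/nandP; left.
have s0 : 0 < sqrt3 by rewrite sqrtr_gt0.
by lra.
Qed.

Ltac form_entries :=
  congr mx2; apply: complex_eq; rewrite /sqnorm /=; have := sqrt3_sqr R; lra.

Lemma straighten_v : takes straighten base_v below.
Proof.
apply: (takes_of_form straighten_unit (ltr0n _ 2)).
by rewrite adjoint_mx2 !mul_mx2 scale_mx2; form_entries.
Qed.

Lemma straighten_w : takes straighten base_w upper.
Proof.
apply: (takes_of_form straighten_unit (ltr0n _ 2)).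
by rewrite adjoint_mx2 !mul_mx2 scale_mx2; form_entries.
Qed.

Lemma straighten_b : takes straighten base_b (unit_below 0).
Proof.
apply: (takes_of_form straighten_unit (ltr0n _ 2)).
by rewrite adjoint_mx2 !mul_mx2 scale_mx2; form_entries.
Qed.

Definition twist (s : R) : 'M[R[i]]_2 :=
  mx2 (1 + s%:C) (- s%:C) s%:C (1 - s%:C).

Lemma twist_unit s : twist s \in unitmx.
Proof.
rewrite unitmxE det_mx2 (_ : _ - _ = 1) ?unitr1 //; ring.
Qed.

(** The twist is parabolic and fixes 1, which [straighten] sends to infinity. In the straightened
    picture it is the translation by -2 sqrt 3 s, and [base_a] itself goes to
    [unit_below (2 * sqrt3)]. *)
Lemma straighten_twist_a s :
  takes (straighten *m twist s) base_a (unit_below (2 * sqrt3 * (1 - s))).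
Proof.
apply: (takes_of_form _ (ltr0n _ 2)).
  by rewrite unitmx_mul straighten_unit twist_unit.
by rewrite mul_mx2 adjoint_mx2 !mul_mx2 scale_mx2; form_entries.
Qed.

(** Undoing [mg] puts [Cv], [Cw], [Cb] in base position and leaves [Ca] at the twist of [base_a].
    The schwarzian thus becomes the horizontal distance 2 sqrt 3 (1 - s) between two unit discs. *)
Lemma patch_normal (Cv Cw Ca Cb : circle R) s : schwarzian Cv Cw Ca Cb s ->
  exists M, M \in unitmx /\
    [/\ takes M Cv below, takes M Cw upper, takes M Cb (unit_below 0) &
        takes M Ca (unit_below (2 * sqrt3 * (1 - s)))].
Proof.
move=> [_ [f [g [[uf ug] [fv fw fa] [gv gw gb] e]]]].
have uV : invmx g \in unitmx by rewrite unitmx_inv.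
have uVf : invmx f \in unitmx by rewrite unitmx_inv.
exists (straighten *m invmx g); split; first by rewrite unitmx_mul straighten_unit.
split.
- exact: takes_mul uV (takes_inv ug gv) straighten_v.
- exact: takes_mul uV (takes_inv ug gw) straighten_w.
- exact: takes_mul uV (takes_inv ug gb) straighten_b.
apply: takes_ext (takes_mul uVf (takes_inv uf fa) (straighten_twist_a s)) => z.
rewrite !moebius_mul ?twist_unit //.
by have /= <- := e (moebius (invmx f) z); rewrite moebiusVK.
Qed.
End Layout.

(** * Circles lying between the two half planes *)

Section Strip.
Variable R : realType.
Implicit Types (z c : R[i]) (C D : circle R).
Local Notation Re := complex.Re.
Local Notation Im := complex.Im.
Local Notation upper := (upper R).
Local Notation below := (below R).

Lemma ImD z c : Im (z + c) = Im z + Im c.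
Proof. by case: z c => x y []. Qed.

Lemma ImM z c : Im (z * c) = Re z * Im c + Im z * Re c.
Proof. by case: z c => x y []. Qed.

Lemma disjointP C D : inner C `&` inner D = set0 <->
  (forall z : sphere R, inner C z -> inner D z -> False).
Proof.
split=> [h z Cz Dz|h]; first by suff : set0 z by []; rewrite -h.
by apply/seteqP; split => // z [Cz Dz]; exact: h Cz Dz.
Qed.

Lemma inner_upper z : inner upper (Some z) <-> 0 < Im z.
Proof. by rewrite inner_HalfPlane subr0 divr1. Qed.

Lemma inner_below z : inner below (Some z) <-> Im z < -2.
Proof.
rewrite inner_HalfPlane invrN invr1 mulrN1; case: z => x y /=.
by split => ?; lra.
Qed.

Lemma inner_upperE : inner upper = Some @` [set z | 0 < Im z].
Proof.
apply/seteqP; split => [[z|]|_ [z zP <-]]; last exact/inner_upper.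
  by move=> /inner_upper zP; exists z.
by case.
Qed.

Lemma inner_belowE : inner below = Some @` [set z | Im z < -2].
Proof.
apply/seteqP; split => [[z|]|_ [z zP <-]]; last exact/inner_below.
  by move=> /inner_below zP; exists z.
by case.
Qed.

Lemma disc_Im_le c (r h : R) (r0 : 0 < r) :
  (forall z, inner (Disc c r0) (Some z) -> Im z <= h) -> Im c + r <= h.
Proof.
case: c => a b hz /=; rewrite leNgt; apply/negP => hlt.
have [hb|hb] := ltP h b.
  have := hz (a +i* b); rewrite inner_Disc /sqnorm /= !subrr expr0n addr0 exprn_gt0 //.
  by move=> /(_ isT); rewrite leNgt hb.
(* The test point is halfway between height [h] and the top of the disc. *)
have := hz (a +i* ((h + b + r) / 2)); rewrite inner_Disc /sqnorm /=.
have h1 : (a - a) ^+ 2 + ((h + b + r) / 2 - b) ^+ 2 < r ^+ 2.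
  by rewrite subrr expr0n add0r ltr_pXn2r // ?nnegrE; lra.
by move=> /(_ h1); lra.
Qed.

Lemma disc_Im_ge c (r h : R) (r0 : 0 < r) :
  (forall z, inner (Disc c r0) (Some z) -> h <= Im z) -> h <= Im c - r.
Proof.
case: c => a b hz /=; rewrite leNgt; apply/negP => hlt.
have [hb|hb] := ltP b h.
  have := hz (a +i* b); rewrite inner_Disc /sqnorm /= !subrr expr0n addr0 exprn_gt0 //.
  by move=> /(_ isT); rewrite leNgt hb.
have := hz (a +i* ((h + b - r) / 2)); rewrite inner_Disc /sqnorm /=.
have h1 : (a - a) ^+ 2 + ((h + b - r) / 2 - b) ^+ 2 < r ^+ 2.
  rewrite subrr expr0n add0r -sqrrN ltr_pXn2r // ?nnegrE; lra.
by move=> /(_ h1); lra.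
Qed.

Lemma codisc_meets_upper c (r : R) (r0 : 0 < r) :
  ~ inner (CoDisc c r0) `&` inner upper = set0.
Proof.
case: c => a b /disjointP h.
have b0 := normr_ge0 b; have b1 := ler_norm (- b); rewrite normrN in b1.
apply: (h (Some (a +i* (b + (r + `|b| + 1))))).
  rewrite inner_CoDisc /sqnorm /= subrr expr0n add0r addrC addKr.
  by rewrite ltr_pXn2r // ?nnegrE; lra.
by apply/inner_upper => /=; lra.
Qed.

(** On a half plane the imaginary part is an affine function of the coordinates along and across the
    boundary line; bounded by the strip, it would be constant, which forces [w = 0]. *)
Lemma halfplane_meets_strip (a w : R[i]) (w0 : w != 0) :
  inner (HalfPlane a w0) `&` inner upper = set0 ->
  inner (HalfPlane a w0) `&` inner below = set0 -> False.
Proof.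
move=> /disjointP hu /disjointP hb.
have mem x y : 0 < y -> inner (HalfPlane a w0) (Some (a + (x +i* y) * w)).
  by move=> y0; rewrite inner_HalfPlane addrAC subrr add0r mulfK.
have strip x y : 0 < y -> -2 <= Im a + (x * Im w + y * Re w) <= 0.
  move=> y0; have e : Im (a + (x +i* y) * w) = Im a + (x * Im w + y * Re w).
    by rewrite ImD ImM.
  rewrite -e !leNgt; apply/andP; split; apply/negP.
    by move=> /inner_below; exact: hb (mem x y y0).
  by move=> /inner_upper; exact: hu (mem x y y0).
have Iw : Im w = 0.
  apply/eqP/negP => /negP Iw.
  (* The shift is chosen to change the height by 3, more than the width 2 of the strip. *)
  have := strip (3 / Im w) 1 ltr01; have := strip 0 1 ltr01.
  by rewrite divfK //; lra.
have Rw : Re w != 0.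
  by apply/eqP => Rw; move/eqP: (w0); apply; exact: complex_eq.
have Rw0 : 0 < `|Re w| by rewrite normr_gt0.
have pos : 0 < 3 / `|Re w| by rewrite divr_gt0.
have := strip 0 1 ltr01; have := strip 0 (1 + 3 / `|Re w|) (addr_gt0 ltr01 pos).
have [e|e] : 3 / `|Re w| * Re w = 3 \/ 3 / `|Re w| * Re w = -3.
- have [p|p] := ltP 0 (Re w); [left; rewrite gtr0_norm // | right; rewrite ler0_norm //]; by field.
- by rewrite mulrDl e; lra.
- by rewrite mulrDl e; lra.
Qed.

Lemma circle_in_strip C :
  inner C `&` inner upper = set0 -> inner C `&` inner below = set0 ->
  exists c (r : R) (r0 : 0 < r), C = Disc c r0 /\ r <= 1.
Proof.
case: C => [c r r0|c r r0|a w w0] hu hb.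
- exists c, r, r0; split => //; move/disjointP in hu; move/disjointP in hb.
  have h1 : Im c + r <= 0.
    apply: (disc_Im_le (r0 := r0)) => z zC.
    by rewrite leNgt; apply/negP => /inner_upper; exact: hu.
  have h2 : -2 <= Im c - r.
    apply: (disc_Im_ge (r0 := r0)) => z zC.
    by rewrite leNgt; apply/negP => /inner_below; exact: hb.
  by lra.
- by case: (codisc_meets_upper hu).
- by case: (halfplane_meets_strip hu hb).
Qed.

Lemma disc_far c (r : R) (r0 : 0 < r) :
  (exists z, inner upper (Some z) /\ ~ inner (Disc c r0) (Some z)) /\
  (exists z, inner below (Some z) /\ ~ inner (Disc c r0) (Some z)).
Proof.
case: c => a b; have b0 := ler_norm b; have b1 := ler_norm (- b); rewrite normrN in b1.
split.
  exists (a +i* (b + (r + `|b| + 1))); split; first by apply/inner_upper => /=; lra.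
  move/inner_Disc; rewrite /sqnorm /= subrr expr0n add0r addrC addKr => h.
  by have : r ^+ 2 <= (r + `|b| + 1) ^+ 2; [rewrite ler_pXn2r // ?nnegrE; lra | lra].
exists (a +i* (b - (r + `|b| + 3))); split; first by apply/inner_below => /=; lra.
move/inner_Disc; rewrite /sqnorm /= subrr expr0n add0r addrC addKr sqrrN => h.
by have : r ^+ 2 <= (r + `|b| + 3) ^+ 2; [rewrite ler_pXn2r // ?nnegrE; lra | lra].
Qed.

(** A normalized layout prescribes interiors only, and one half plane has many presentations, so
    facts about curves must be recovered. Discs are bounded and complements of discs contain
    infinity, which leaves [HalfPlane]. *)
Lemma curve_None C D : inner C = inner D -> D = upper \/ D = below ->
  curve C None.
Proof.
case: C => [c r r0|c r r0|a w w0] e DE; last by left.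
  have [[z [zu zC]] [z' [zb z'C]]] := disc_far c r0.
  by case: DE => DE; rewrite DE in e; rewrite e in zC z'C.
have : inner (CoDisc c r0) None by left.
by rewrite e; case: DE => -> /=; case.
Qed.

(** Moving [t] inward by any [d > 0] lands in the upper half plane at height [Im t + d * Re w]; a
    negative [Im t] is refuted by a suitable [d]. *)
Lemma curve_upper_Im C t : inner C = inner upper -> curve C (Some t) -> 0 <= Im t.
Proof.
move=> e; have := curve_None e (or_introl erefl).
case: C e => [c r r0 _ []//|c r r0 _ []//|a w w0 e _ /curve_HalfPlane ht].
have h (d : R) : 0 < d -> 0 < Im t + d * Re w.
  move=> d0; have /inner_upper : inner upper (Some (t + (0 +i* d) * w)).
    rewrite -e; apply/inner_HalfPlane.
    by rewrite addrAC mulrDl mulfK //; case: ((t - a) / w) ht => x y /= ->; rewrite add0r.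
  by rewrite ImD ImM /= mul0r add0r.
rewrite leNgt; apply/negP => t0.
have [w1|w1] := leP (Re w) 0; first by have := h 1 ltr01; lra.
have d0 : 0 < - Im t / Re w by rewrite divr_gt0 // oppr_gt0.
by have := h _ d0; rewrite divfK ?gt_eqF //; lra.
Qed.

(** A boundary point of nonnegative height puts the centre at height at least -r, so the disc stays
    above -2r, which is at least -2. *)
Lemma shallow_disc_disjoint c (r : R) (r0 : 0 < r) t :
  curve (Disc c r0) (Some t) -> 0 <= Im t -> r <= 1 ->
  inner (Disc c r0) `&` inner below = set0.
Proof.
move=> /curve_Disc ht t0 r1; apply/disjointP => -[z|_ []//].
move=> /inner_Disc zc /inner_below zb.
have h1 : (Im t - Im c) ^+ 2 <= r ^+ 2.
  by rewrite -ht /sqnorm; case: (t) (c) => ? ? [? ?] /=; rewrite lerDr sqr_ge0.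
have h2 : (Im z - Im c) ^+ 2 < r ^+ 2.
  by apply: le_lt_trans zc; rewrite /sqnorm; case: (z) (c) => ? ? [? ?] /=; rewrite lerDr sqr_ge0.
have h3 : Im t - Im c <= r by rewrite leNgt; apply/negP => ?; nra.
have h4 : - r < Im z - Im c by rewrite ltNge; apply/negP => ?; nra.
by lra.
Qed.

Lemma disc_tangent_dist (c c' : R[i]) (r r' : R) (r0 : 0 < r) (r0' : 0 < r') :
  tangent (Disc c r0) (Disc c' r0') -> `|c - c'| <= (r + r')%:C.
Proof.
move=> [t [ht _]]; have : (curve (Disc c r0) `&` curve (Disc c' r0')) t by rewrite ht.
move=> [[z zc <-] [z' z'c [e]]]; rewrite /= in zc z'c; rewrite e in z'c.
by rewrite rmorphD /= -zc -z'c (distrC z c) ler_distD.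
Qed.

End Strip.

(** * Index arithmetic modulo n *)

Section Cyclic.
Variable n : nat.
Implicit Types (i j : 'I_n).

Lemma val_iter_ordS k i : iter k (@ordS n) i = ((i + k) %% n)%N :> nat.
Proof.
elim: k => [|k IH]; first by rewrite addn0 modn_small.
by rewrite iterS /= IH -addn1 modnDml addn1 addnS.
Qed.

Lemma iter_ordS_ordS k i : iter k (@ordS n) (ordS i) = ordS (iter k (@ordS n) i).
Proof. by rewrite -iterSr. Qed.

Lemma iter_ordS_ord_pred k i :
  iter k (@ordS n) (ord_pred i) = ord_pred (iter k (@ordS n) i).
Proof. by apply: ordS_inj; rewrite -iter_ordS_ordS !ord_predK. Qed.

Lemma iter_ordS_inj k : injective (iter k (@ordS n)).
Proof. by elim: k => [|k IH] i j //= /ordS_inj/IH. Qed.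

Lemma iter_ordS_exists i j : exists2 k, (k < n)%N & j = iter k (@ordS n) i.
Proof.
exists ((n - i + j) %% n)%N; first by rewrite ltn_pmod // (leq_ltn_trans _ (ltn_ord i)).
apply/val_inj; rewrite /= val_iter_ordS modnDmr.
by rewrite addnA subnKC ?modnDl ?modn_small // ltnW.
Qed.

Lemma iter_ordS_n i : iter n (@ordS n) i = i.
Proof. by apply/val_inj; rewrite /= val_iter_ordS modnDr modn_small. Qed.

End Cyclic.

(** * Re-indexing of flowers, and rigidity of the u-label *)

Section Rotation.
Variables (R : realType) (n : nat).
Implicit Types (F G : flower R n) (p : 'I_n -> R).

Definition rotate k F : flower R n :=
  Flower (center F) (fun j => petal F (iter k (@ordS n) j)).

Lemma is_flower_rotate k F : is_flower F -> is_flower (rotate k F).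
Proof.
move=> [n3 hc hp]; by split=> //= j; rewrite iter_ordS_ordS.
Qed.

Lemma is_ulabel_rotate k F p :
  is_ulabel F p -> is_ulabel (rotate k F) (cyclic_shift p k).
Proof.
move=> h j; have [s hs ps] := h (iter k (@ordS n) j); exists s => //=.
by rewrite iter_ordS_ordS iter_ordS_ord_pred.
Qed.

Lemma unbranched_rotate k F : unbranched F -> unbranched (rotate k F).
Proof.
move=> [M [G [tau [l [[uM Mc Mp] Gc Gt h hs]]]]].
exists M, (rotate k G), (tau \o iter k (@ordS n)), (l \o iter k (@ordS n)).
split => //.
- by split => //= j; exact: Mp.
- by move=> j; exact: Gt.
- by move=> j /=; rewrite iter_ordS_ordS; exact: h.
- by rewrite -hs [RHS](reindex_inj (@iter_ordS_inj n k)).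
Qed.

(** Consecutive patches share the centre and two adjacent petals, a tangent triple, so their
    matching maps agree. The map found at petal 0 therefore propagates around the flower. *)
Lemma ulabel_rigid F G p : (0 < n)%N -> is_ulabel F p -> is_ulabel G p ->
  exists M, takes_flower M F G.
Proof.
move=> n0 hF hG.
have rigid j : exists M, [/\ M \in unitmx, takes M (petal F j) (petal G j),
    takes M (center F) (center G),
    takes M (petal F (ord_pred j)) (petal G (ord_pred j)) &
    takes M (petal F (ordS j)) (petal G (ordS j))].
  have [s hs ps] := hF j; have [s' hs' ps'] := hG j.
  have e : s = s' by apply: oppr_inj; apply: (addrI 1); rewrite -ps -ps'.
  by rewrite -e in hs'; exact: patch_rigid hs hs'.
have [M [uM M0 Mc _ M1]] := rigid (Ordinal n0).
exists M; split => // j; have [k _ ->] := iter_ordS_exists (Ordinal n0) j.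
pose T i := takes M (petal F i) (petal G i).
(* The induction carries two adjacent petals, because with the centre they form the triple that
   determines the map. *)
suff [] : T (iter k (@ordS n) (Ordinal n0)) /\
          T (ordS (iter k (@ordS n) (Ordinal n0))) by [].
elim: k => [//|k [Mk MSk]]; rewrite iterS; split => //.
move: (iter k _ _) Mk MSk => i Mi MSi.
have [N [uN N0 Nc Np Ns]] := rigid (ordS i).
(* Only [f] is extracted: it exhibits that triple as an image of the base triple. *)
have [s [_ [f [g [[uf _] [fv fw fa] _ _]]]] _] := hF (ordS i).
rewrite ordSK in Np fa.
exact: takes_ext (takes_triple_unique uN uM uf fv fw fa N0 Nc Np MSi Mc Mi) Ns.
Qed.

End Rotation.

(** * Distinct tangency points in an un-branched flower *)

Section Arcs.
Variable R : realType.

Definition cis (x : R) : R[i] := cos x +i* sin x.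

Lemma cisD x y : cis (x + y) = cis x * cis y.
Proof. by rewrite /cis cosD sinD; simpc; congr (_ +i* _); rewrite addrC. Qed.

Lemma cis_neq1 x : 0 < x < 2 * pi -> cis x != 1.
Proof.
move=> /andP[x0 x2]; rewrite eq_complex /=; apply/nandP; left.
have -> : x = (x / 2) *+ 2 by rewrite -mulr_natr divfK ?pnatr_eq0.
have := @sin_gt0_pi R (x / 2); rewrite divr_gt0 //= ltr_pdivrMr // mulrC x2 => /(_ isT) s0.
rewrite cos_mulr2n cos2sin2; have s2 : 0 < sin (x / 2) ^+ 2 by rewrite exprn_gt0.
by apply/negP => /eqP; lra.
Qed.

(** A point of a petal on the central circle is its tangency point. The arcs from petal 0 to petal
    [j] sum to an angle strictly between 0 and 2 pi when [j] is not 0, so the tangency points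
    differ. *)
Lemma unbranched_contact (n : nat) (F : flower R n) (i j : 'I_n)
    (t : sphere R) : i = 0%N :> nat -> unbranched F ->
  curve (petal F i) t -> curve (petal F j) t -> curve (center F) t -> i = j.
Proof.
move=> i0 [M [G [tau [l [[uM Mc Mp] Gc Gt h hs]]]]] it jt ct.
have tauE k : curve (petal F k) t -> moebius M t = Some (tau k).
  move=> kt; have [e _] := Gt k.
  have : (curve (petal G k) `&` curve (center G)) (moebius M t).
    by split; [apply/(takes_curve _ uM (Mp k)) | apply/(takes_curve _ uM Mc)].
  by rewrite e.
have tij : tau i = tau j by have := tauE i it; rewrite (tauE j jt) => -[].
(* The origin is interior to the central circle, where the form is negative, while [tau i] is a zero
   of the form. *)
have tau0 : tau i != 0.
  apply/eqP => t0; have [e _] := Gt i.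
  have [_ /curveE] : (curve (petal G i) `&` curve (center G)) (Some (tau i)) by rewrite e.
  have /innerE : inner (center G) (Some (tau i)).
    by rewrite Gc t0; exists 0 => //=; rewrite normr0 ltr01.
  by move=> /[swap] ->; rewrite ltxx.
have arc m (mn : (m < n)%N) :
    tau (Ordinal mn) = tau i * cis (\sum_(k < n | (k < m)%N) l k).
  elim: m mn => [|m IH] mn.
    rewrite big_pred0 // /cis cos0 sin0 (_ : 1 +i* 0 = 1) // mulr1; congr tau.
    by apply/val_inj.
  have mn' := ltnW mn.
  have -> : Ordinal mn = ordS (Ordinal mn') by apply/val_inj; rewrite /= modn_small.
  rewrite (h _).2 IH -mulrA -/(cis _) -cisD; congr (_ * cis _).
  rewrite [RHS](bigD1 (Ordinal mn')) //= addrC; congr (_ + _); apply: eq_bigl => k.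
  by rewrite ltnS [in RHS]leq_eqVlt -val_eqE /=; case: ltngtP.
apply/eqP; apply: contraTT isT => ij.
have j0 : (0 < j)%N by rewrite lt0n -i0 eq_sym.
have lp k : 0 < l k by have [/andP[]] := h k.
have S0 : 0 < \sum_(k < n | (k < j)%N) l k.
  rewrite (bigD1 i) ?i0 //= ltr_pwDl // sumr_ge0 // => k _; exact: ltW.
have S1 : \sum_(k < n | (k < j)%N) l k < 2 * pi.
  rewrite -hs [X in _ < X](bigID (fun k : 'I_n => (k < j)%N)) /= ltrDl.
  rewrite (bigD1 j) ?ltnn //= ltr_pwDl // sumr_ge0 // => k _; exact: ltW.
have := arc j (ltn_ord j); have -> : Ordinal (ltn_ord j) = j by apply/val_inj.
rewrite -tij -[LHS]mulr1 => /(mulfI tau0) /esym/eqP e.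
by have := @cis_neq1 _ (introT andP (conj S0 S1)); rewrite e.
Qed.

End Arcs.

(** * Layout radii, bounds on the u-label, and the equivalence *)

Section Main.
Variables (R : realType) (n : nat).
Hypothesis n3 : (3 < n)%N.
Implicit Types (F L : flower R n) (p : 'I_n -> R).
Local Notation Re := complex.Re.
Local Notation Im := complex.Im.
Local Notation upper := (upper R).
Local Notation below := (below R).
Local Notation sqrt3 := (Num.sqrt 3 : R).

Lemma tangent_at_unit_below : tangent_at (unit_below (0 : R)) upper (Some 0).
Proof.
split.
  apply/seteqP; split => [[[x y]|]|_ ->].
  - move=> [/curve_Disc + /curve_HalfPlane]; rewrite subr0 divr1 /sqnorm /= => xy y0.
    rewrite y0 in xy *; have /eqP : x ^+ 2 = 0 by lra.
    by rewrite sqrf_eq0 => /eqP ->.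
  - by case=> -[].
  - split; first by apply/curve_Disc; rewrite /sqnorm /=; lra.
    by apply/curve_HalfPlane; rewrite subr0 divr1.
apply/disjointP => -[[x y]|[] //] /inner_Disc + /inner_upper.
by rewrite /sqnorm /= => *; nra.
Qed.

Lemma ord_pred_val (j : 'I_n) : ord_pred j = iter (n - 2) (@ordS n) (ordS j).
Proof.
apply: ordS_inj; rewrite ord_predK -iter_ordS_ordS -[LHS]iter_ordS_n.
by rewrite -!iterSr; congr (iter _ _ _); lia.
Qed.

Lemma normalized_layout_exists F p :
  is_flower F -> unbranched F -> is_ulabel F p -> exists L, normalized_layout p L.
Proof.
move=> hF hu hp; have n0 : (0 < n)%N by lia.
have [s hs _] := hp (Ordinal n0); have [M [uM [Mv Mw Mb _]]] := patch_normal hs.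
(* The image of petal 1 is chosen as [unit_below 0] itself, since the layout prescribes its radius
   and tangency point; the other images are arbitrary presentations. *)
have /choice [D DP] : forall j : 'I_n, exists D, takes M (petal F j) D /\
    (j = 1%N :> nat -> D = unit_below 0).
  move=> j; have [j1|j1] := eqVneq (j : nat) 1%N.
    exists (unit_below 0); split => //; suff -> : j = ordS (Ordinal n0) by [].
    by apply/val_inj; rewrite /= modn_small //; lia.
  have [D DP] := takes_exists (petal F j) uM; exists D; split => // j1'.
  by rewrite j1' in j1.
exists (Flower upper D); split.
  by exists F, M; split => //; split => // j; exact: (DP j).1.
split => /= [|j j0|j j1]; first exact: inner_upperE.
  have <- : inner below = inner (D j); last exact: inner_belowE.
  by have [[_ <-] _] := DP j; have [_ <-] := Mv; congr (_ @` inner (petal F _)); apply/val_inj.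
by rewrite (DP j).2 //; split => //; exact: tangent_at_unit_below.
Qed.

Section NormalizedPetal.
Variables (L : flower R n) (p : 'I_n -> R) (j0 j : 'I_n).
Hypotheses (hL : normalized_layout p L) (j00 : j0 = 0%N :> nat).

Lemma layout_center : inner (center L) = inner upper.
Proof. by have [_ [-> _ _]] := hL; rewrite inner_upperE. Qed.

Lemma layout_petal0 : inner (petal L j0) = inner below.
Proof. by have [_ [_ /(_ _ j00) -> _]] := hL; rewrite inner_belowE. Qed.

Lemma layout_tangent k : tangent (center L) (petal L k).
Proof.
have [[F [M [[_ hc _] _ _ [uM Mc Mp]]]] _] := hL.
by have [t ht] := hc k; exists (moebius M t); exact: takes_tangent_at Mc (Mp k) ht.
Qed.

Lemma layout_radius_le1 :
  inner (petal L j) `&` inner (petal L j0) = set0 -> radius (petal L j) <= 1.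
Proof.
rewrite layout_petal0 => hb; have [t [_]] := layout_tangent j.
rewrite layout_center setIC => hu.
by have [c [r [r0 [-> r1]]]] := circle_in_strip hu hb.
Qed.

Lemma layout_disjoint : j != j0 -> radius (petal L j) <= 1 ->
  inner (petal L j) `&` inner (petal L j0) = set0.
Proof.
move=> jj0 r1; rewrite layout_petal0.
have [t [ht]] := layout_tangent j; rewrite layout_center setIC => hu.
have [tc tj] : (curve (center L) `&` curve (petal L j)) t by rewrite ht.
case E : (petal L j) r1 hu tj => [c r r0|c r r0|a v v0] /= r1 hu tj.
- case: t tj tc {ht} => [t|[] //] tj tc.
  exact: shallow_disc_disjoint tj (curve_upper_Im layout_center tc) r1.
- by case: (codisc_meets_upper hu).
(* [radius] is 0 at a half plane, so the bound alone does not exclude this case. Here petals 0 and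
   [j] and the centre would all pass through infinity, contradicting [unbranched_contact]. *)
- have [[F [M [_ hb _ [uM Mc Mp]]]] _] := hL.
  have cN := curve_None layout_center (or_introl erefl).
  have c0 := curve_None layout_petal0 (or_intror erefl).
  have cj : curve (petal L j) None by rewrite E; left.
  case/eqP: jj0; apply/esym.
  apply: (unbranched_contact (t := moebius (invmx M) None) j00 hb);
    apply/(takes_curve _ uM); rewrite ?moebiusVK //; eauto.
Qed.

End NormalizedPetal.

(* [layout_radius] is read off some flower with u-label [p], which
   [ulabel_rigid] identifies with [F] up to a Moebius transformation. *)
Lemma layout_radiusP F p (j0 j : 'I_n) :
  is_flower F -> unbranched F -> is_ulabel F p -> j0 = 0%N :> nat -> j != j0 ->
  layout_radius p j <= 1 <-> inner (petal F j) `&` inner (petal F j0) = set0.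
Proof.
move=> hF hu hp j00 jj0; rewrite /layout_radius.
have [L0 hL0] := normalized_layout_exists hF hu hp.
(* The layout [L0] shows the set nonempty, so [xget] returns the radius of a genuine layout and not
   the default 0. *)
have [L hL <-] := @xgetPex _ 0 [set r | exists2 L, normalized_layout p L & radius (petal L j) = r]
  (ex_intro _ _ (ex_intro2 _ _ L0 hL0 erefl)).
have [[G [M [_ _ hG [uM Mc Mp]]]] _] := hL.
have n0 : (0 < n)%N by lia.
have [N [uN Nc Np]] := ulabel_rigid n0 hp hG.
rewrite (takes_disjoint uN (Np j) (Np j0)) (takes_disjoint uM (Mp j) (Mp j0)).
split; first exact: layout_disjoint hL j00 jj0.
exact: layout_radius_le1 hL j00.
Qed.

Lemma univalent_ulabel_bounds F p (j : 'I_n) :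
  is_flower F -> is_ulabel F p -> univalent F -> 0 < p j ->
  1 / sqrt3 <= p j <= (n%:R - 2) / sqrt3.
Proof.
move=> [_ hc hpt] hp [_ hd] pj0.
have [s hs pE] := hp j; have [M [uM [Mv Mw Mb Ma]]] := patch_normal hs.
rewrite -pE in Ma.
have s30 : 0 < sqrt3 by rewrite sqrtr_gt0.
have s33 : sqrt3 * sqrt3 = 3 by rewrite -expr2 sqr_sqrtr.
have iterj m : (m <= n - 2)%N -> iter m (@ordS n) (ordS j) != j.
  move=> mn; apply/eqP => /(congr1 val) /=; rewrite val_iter_ordS /= modnDml.
  move=> e; have : (j + m.+1 = j + 0 %[mod n])%N.
    by rewrite addn0 (modn_small (ltn_ord j)) -[RHS]e; congr (_ %% _)%N; lia.
  by move/eqP; rewrite eqn_modDl !modn_small //; lia.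
rewrite ler_pdivrMr // ler_pdivlMr //; apply/andP; split.
  rewrite leNgt; apply/negP => lt.
  have ne : ord_pred j != ordS j.
    rewrite ord_pred_val -[X in _ != X]/(iter 0 (@ordS n) (ordS j)).
    apply/eqP => /(congr1 val) /=; rewrite val_iter_ordS /= modnDml => e.
    have : (j.+1 + (n - 2) = j.+1 + 0 %[mod n])%N by rewrite addn0.
    by move/eqP; rewrite eqn_modDl !modn_small //; lia.
  have /(takes_disjoint uM Ma Mb) /disjointP h := hd _ _ ne.
  have x0 : 0 < p j * sqrt3 by rewrite mulr_gt0.
  have xE : 2 * sqrt3 * p j = 2 * (p j * sqrt3) by ring.
  rewrite xE in h; move: (p j * sqrt3) lt x0 h => x x1 x0 h.
  have xx : x ^+ 2 < 1 by nra.
  (* The midpoint of the two centres is at distance [x < 1] from each, so it lies in both unit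
     discs. *)
  by apply: (h (Some (x -i* 1))); apply/inner_Disc; rewrite /sqnorm /=; lra.
(* By univalence every petal on the walk lies in the strip and has radius at most 1, so each
   tangency moves the centre by at most 2. *)
have chain m : (m <= n - 2)%N -> exists c (r : R) (r0 : 0 < r),
    [/\ takes M (petal F (iter m (@ordS n) (ordS j))) (Disc c r0), r <= 1 &
        `|c - (0 -i* 1)| <= (2 * m%:R)%:C].
  elim: m => [|m IH] mn.
    exists (0 -i* 1), 1, ltr01; split => //.
    by rewrite subrr normr0 mulr0.
  have [c [r [r0 [tc r1 cm]]]] := IH (ltnW mn).
  have [D tD] := takes_exists (petal F (iter m.+1 (@ordS n) (ordS j))) uM.
  have hb : inner D `&` inner below = set0.
    by apply/(takes_disjoint uM tD Mv); apply: hd; exact: iterj.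
  have hu : inner D `&` inner upper = set0.
    have [t [_]] := hc (iter m.+1 (@ordS n) (ordS j)).
    by rewrite setIC => /(takes_disjoint uM tD Mw).
  have [c' [r' [r0' [DE r1']]]] := circle_in_strip hu hb.
  exists c', r', r0'; rewrite -DE; split => //.
  have [t ht] := hpt (iter m (@ordS n) (ordS j)).
  have : tangent (Disc c r0) (Disc c' r0').
    by exists (moebius M t); rewrite -DE; exact: takes_tangent_at tc tD ht.
  move=> /disc_tangent_dist; rewrite distrC => cc'.
  apply: le_trans (ler_distD c _ _) _; apply: le_trans (lerD cc' cm) _.
  by rewrite -rmorphD /= lecR -natr1; lra.
(* The chain stops at c_(j-2); the last tangency is with the explicit disc that [patch_normal] gives
   for c_(j-1), for a total of at most 2(n - 3) + 2. *)
have [|c [r [r0 [tc r1 cn]]]] := chain (n - 3)%N; first lia.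
have [t ht] := hpt (iter (n - 3) (@ordS n) (ordS j)).
rewrite -iterS (_ : (n - 3).+1 = n - 2)%N in ht; last lia.
rewrite -ord_pred_val in ht.
have /disc_tangent_dist : tangent (Disc c r0) (unit_below (2 * sqrt3 * p j)).
  by exists (moebius M t); exact: takes_tangent_at tc Ma ht.
rewrite distrC => dc; have := le_trans (ler_distD c _ _) (lerD dc cn).
have -> : ((2 * sqrt3 * p j) -i* 1) - (0 -i* 1) = (2 * sqrt3 * p j)%:C.
  by apply: complex_eq => /=; ring.
rewrite ger0_norm; last by rewrite ler0c !mulr_ge0 ?ltW.
rewrite -rmorphD /= lecR natrB; last by lia.
by lra.
Qed.

End Main.

Theorem theorem4p6 (R : realType) (n : nat) (hn : (3 < n)%N)
  (F : flower R n) (p : 'I_n -> R)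
  (hF : is_flower F) (hunb : unbranched F)
  (hp : is_ulabel F p) (hpos : forall j : 'I_n, 0 < p j) :
  univalent F <->
  (forall j : 'I_n,
     1 / Num.sqrt 3 <= p j <= (n%:R - 2) / Num.sqrt 3) /\
  (forall j k : 'I_n, (2 <= j <= n - 2)%N ->
     layout_radius (cyclic_shift p k) j <= 1).
Proof.
have n0 : (0 < n)%N by lia.
(* In the flower rotated by [k], petal 0 is c_k and petal [j] is c_(k+j). *)
have radP (j k : 'I_n) : j != Ordinal n0 ->
    layout_radius (cyclic_shift p k) j <= 1 <->
    inner (petal F (iter k (@ordS n) j)) `&` inner (petal F k) = set0.
  move=> j0; have := layout_radiusP hn (is_flower_rotate k hF)
    (unbranched_rotate k hunb) (is_ulabel_rotate k hp) (erefl : Ordinal n0 = 0%N :> nat) j0.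
  suff e : iter k (@ordS n) (Ordinal n0) = k by rewrite /= e.
  by apply/val_inj; rewrite /= val_iter_ordS add0n modn_small.
split=> [hu|[_ hr]].
  split=> [j|j k jn]; first exact: (univalent_ulabel_bounds hn hF hp hu (hpos j)).
  have [_ hd] := hu.
  apply/radP; first by rewrite -val_eqE /=; lia.
  apply: hd; apply/eqP => /(congr1 val) /=; rewrite val_iter_ordS => e.
  have : (k + j = k + 0 %[mod n])%N by rewrite addn0 (modn_small (ltn_ord k)) addnC.
  by move/eqP; rewrite eqn_modDl !modn_small //; lia.
split=> // j k jk; have [_ _ ht] := hF.
(* Write the pair as c_k and c_(k+m). For [m = 1] and [m = n - 1] the petals are neighbours, hence
   disjoint by tangency; the remaining [m] form exactly the range of (B). *)
have [m mn jE] := iter_ordS_exists k j.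
have [m0|m0] := posnP m; first by rewrite jE m0 eqxx in jk.
have [m1|m1] := eqVneq m 1%N.
  by have [t [_]] := ht k; rewrite setIC jE m1.
have [mn1|mn1] := eqVneq m n.-1.
  have [t [_]] := ht j; suff -> : ordS j = k by [].
  by rewrite jE mn1 -iterS prednK // iter_ordS_n.
have -> : j = iter k (@ordS n) (Ordinal mn).
  by rewrite jE; apply/val_inj; rewrite /= !val_iter_ordS addnC.
apply/(radP (Ordinal mn) k); first by rewrite -val_eqE /= -lt0n.
by apply: hr => /=; lia.
Qed.
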